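(* If $X$ is a $1$-dimensional dart whose characteristic function $\phi_X(t)=Ee^{itX}$, $t\in\mathbb{R}$, is analytic and has a (real) zero, then $(X,\cos x)$ is not reasonable.
   Context: A $1$-dimensional dart is a random variable $X$ taking values in $\mathbb{R}$. A payoff function is a measurable function $f:\mathbb{R}\to\mathbb{R}$ bounded from above. For $d>0$, $g_{X,f}(d):=\sup_{a\in\mathbb{R}}Ef(a+dX)$. The pair $(X,f)$ is reasonable if $g_{X,f}(d)$ is decreasing (i.e. non-increasing) in $d\in(0,\infty)$. Here $(X,\cos x)$ means $f(x)=\cos x$. Analytic means real-analytic on $\mathbb{R}$. *)

(* Defs.v *)
From mathcomp Require Import all_boot all_order all_algebra.
From mathcomp Require Import complex.
From mathcomp Require Import all_classical all_reals all_analysis.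
From mathcomp Require Import measurable_realfun.

Set Implicit Arguments.
Unset Strict Implicit.
Unset Printing Implicit Defensive.

Import Order.TTheory GRing.Theory Num.Theory.
Import numFieldNormedType.Exports.

Local Open Scope classical_set_scope.
Local Open Scope ring_scope.
Local Open Scope complex_scope.

Record payoff (R : realType) := Payoff {
  payoff_fun :> R -> R;
  payoff_measurable : measurable_fun setT payoff_fun;
  payoff_bounded_above : has_ubound (range payoff_fun) }.

Lemma measurable_cos_setT (R : realType) : measurable_fun setT (@cos R).
Proof. by apply: continuous_measurable_fun; exact: continuous_cos. Qed.

Lemma cos_bounded_above (R : realType) : has_ubound (range (@cos R)).
Proof. by exists 1 => _ [x _ <-]; exact: cos_le1. Qed.

Definition cos_payoff (R : realType) : payoff R :=
  Payoff (@measurable_cos_setT R) (@cos_bounded_above R).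

(* A payoff is only bounded from above, so [E f(a + rX)] may be [-oo]; the
   supremum is therefore taken in the extended reals. *)
Definition gain d (T : measurableType d) (R : realType) (P : probability T R)
    (X : {RV P >-> R}) (f : payoff R) (r : R) : \bar R :=
  ereal_sup [set 'E_P[fun w => f (a + r * X w)%R]%E | a in [set: R]].

Definition reasonable d (T : measurableType d) (R : realType)
    (P : probability T R) (X : {RV P >-> R}) (f : payoff R) : Prop :=
  forall r s : R, 0 < r -> r <= s -> (gain X f s <= gain X f r)%E.

(* [expi x] is e^{ix}. *)
Definition expi (R : realType) (x : R) : R[i] := cos x +i* sin x.

(* [fine] sends infinite values to 0; this is harmless when [Re \o Z] and
   [Im \o Z] are integrable, in particular for the bounded [Z] of [charfun]. *)
Definition complex_expectation d (T : measurableType d) (R : realType)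
    (P : probability T R) (Z : T -> R[i]) : R[i] :=
  fine ('E_P[fun w => complex.Re (Z w)])%E
    +i* fine ('E_P[fun w => complex.Im (Z w)])%E.

Definition charfun d (T : measurableType d) (R : realType)
    (P : probability T R) (X : {RV P >-> R}) (t : R) : R[i] :=
  complex_expectation P (fun w => expi (t * X w)).

(* [R[i]^o] is [R[i]] with the topology of its modulus. *)
Definition real_analytic (R : realType) (phi : R -> R[i]) : Prop :=
  forall t0 : R, exists (c : nat -> R[i]) (e : R), 0 < e /\
    forall t : R, `|t - t0| < e ->
      series (fun n => c n * (t - t0)%:C ^+ n : R[i]^o) @ \oo
        --> (phi t : R[i]^o).

(* Main.v *)
Require Import Defs.
From mathcomp Require Import all_boot all_order all_algebra.
From mathcomp Require Import complex.
From mathcomp Require Import all_classical all_reals all_analysis.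
From mathcomp Require Import measurable_realfun ring lra.

(** Expanding [cos (a + r X)] shows that its expectation is the real part of
    [e^{ia} phi(r)], where [phi] is the characteristic function of [X]
    ([expectation_cos_charfun]); its supremum over [a] is [|phi(r)|].  A
    nonincreasing gain therefore keeps [phi] at zero to the right of any
    positive zero ([gain_cos_eq0], [charfun_eq0_gain]).  Since [phi(0) = 1] and
    [phi(-t)] is the conjugate of [phi(t)], a real zero yields a positive one,
    so [phi] vanishes on a half-line.

    An analytic function vanishing on a half-line vanishes everywhere
    ([real_analytic_eq0]), which contradicts [phi(0) = 1].  This case of the
    identity theorem follows by expanding [phi] at the left endpoint [s] of the
    largest half-line of zeros: the power series at [s] is zero for small
    positive increments, hence has zero coefficients
    ([complex_pseries_coef_eq0]), hence is zero to the left of [s] as well. *)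

Set Implicit Arguments.
Unset Strict Implicit.
Unset Printing Implicit Defensive.

Import Order.TTheory GRing.Theory Num.Theory.
Import numFieldNormedType.Exports.

Local Open Scope ring_scope.

(** * Power series vanishing on a right neighbourhood of the centre *)

(** The summand [2 x^(k + j)] dominates the rest of the geometric series and
    makes the bound provable by induction on [j]. *)
Lemma geometric_tail_le (R : realType) (x : R) (k j : nat) :
  0 < x -> x <= 1 / 2 ->
  \sum_(k <= n < k + j) x ^+ n + 2 * x ^+ (k + j) <= 2 * x ^+ k.
Proof.
move=> x0 x12; elim: j => [|j IH]; first by rewrite addn0 big_geq// add0r.
rewrite addnS big_nat_recr ?leq_addr//= exprS.
apply: le_trans IH; rewrite -addrA lerD2l.
have := exprn_ge0 (k + j) (ltW x0); nra.
Qed.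

(** If [b m] is the first nonzero coefficient, dividing the series by [x^m]
    leaves [b m] plus a tail of size at most [2 M x], which is smaller than
    [|b m|] once [x] is small enough. *)
Lemma bounded_pseries_eq0 (R : realType) (b : nat -> R) (M : R) :
  (forall n, `|b n| <= M) ->
  (forall x : R, 0 < x -> x <= 1 / 2 ->
    (series (fun n => b n * x ^+ n) @ \oo --> (0 : R))%classic) ->
  forall n, b n = 0.
Proof.
move=> bM sum0; elim/ltn_ind => m IH.
have lead_le x : 0 < x -> x <= 1 / 2 -> `|b m| <= 2 * M * x.
  move=> x0 x12; have xm : 0 < x ^+ m by exact: exprn_gt0.
  rewrite -(ler_pM2r xm); apply/ler_addgt0Pr => eps eps0.
  (* The partial sum up to [m + 1 + N] is within [eps] of zero, and consists of
     the term of index [m] and a tail bounded by a geometric sum. *)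
  have /cvgrPdist_lt/(_ eps eps0)[N _ small] := sum0 x x0 x12.
  have {small} := small (m.+1 + N)%N (leq_addl _ _).
  rewrite /= sub0r normrN seriesEnat/= (big_cat_nat _ (n := m.+1))//= ?leq_addr//.
  rewrite big_nat_recr//= big_nat big1 => [|i /= im]; last first.
    by rewrite IH// mul0r.
  rewrite add0r => small.
  have tail : `|\sum_(m.+1 <= n < m.+1 + N) b n * x ^+ n| <=
              M * \sum_(m.+1 <= n < m.+1 + N) x ^+ n.
    rewrite mulr_sumr; apply: le_trans (ler_norm_sum _ _ _) _.
    apply: ler_sum => n _; rewrite normrM (gtr0_norm (exprn_gt0 _ x0)).
    by apply: ler_wpM2r; [exact/ltW/exprn_gt0|].
  have M0 : 0 <= M := le_trans (normr_ge0 _) (bM 0%N).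
  have geo : \sum_(m.+1 <= n < m.+1 + N) x ^+ n <= 2 * (x * x ^+ m).
    rewrite -exprS; apply: le_trans (geometric_tail_le m.+1 N x0 x12).
    by rewrite lerDl mulr_ge0// ltW// exprn_gt0.
  have tail' := le_trans tail (ler_wpM2l M0 geo).
  have := lerB_dist (b m * x ^+ m)
    (- \sum_(m.+1 <= n < m.+1 + N) b n * x ^+ n).
  rewrite normrN opprK normrM (gtr0_norm xm).
  lra.
apply/eqP/negPn/negP => bm0; have bm : 0 < `|b m| by rewrite normr_gt0.
have M0 : 0 < M := lt_le_trans bm (bM m).
(* At this point the bound [2 M x] on [|b m|] equals half of [|b m|]. *)
have x0 : 0 < `|b m| / (4 * M) by rewrite divr_gt0// mulr_gt0.
have x12 : `|b m| / (4 * M) <= 1 / 2.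
  by rewrite ler_pdivrMr ?mulr_gt0//; have := bM m; lra.
have := lead_le _ x0 x12.
have -> : 2 * M * (`|b m| / (4 * M)) = `|b m| / 2 by field; rewrite gt_eqF.
lra.
Qed.

(** Rescaling the variable by [e / 2], a point of convergence, makes the
    coefficients bounded: they are the terms of a convergent series. *)
Lemma pseries_coef_eq0 (R : realType) (a : nat -> R) (e : R) : 0 < e ->
  (forall h : R, 0 < h -> h < e ->
    (series (fun n => a n * h ^+ n) @ \oo --> (0 : R))%classic) ->
  forall n, a n = 0.
Proof.
move=> e0 sum0 n; have e2 : 0 < e / 2 by lra.
pose b n := a n * (e / 2) ^+ n.
have [M bM] : exists M, forall n, `|b n| <= M.
  have b0 : (series b @ \oo --> (0 : R))%classic by apply: sum0 => //; lra.
  have /cvgP/cvg_seq_bounded[M [_ bM]] := cvg_series_cvg_0 (cvgP _ b0).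
  by exists (M + 1) => k; apply: bM => //; rewrite ltrDl.
have : b n = 0.
  apply: (bounded_pseries_eq0 bM) => x x0 x12.
  suff -> : (fun n => b n * x ^+ n) = (fun n => a n * (e / 2 * x) ^+ n).
    by apply: sum0; [rewrite mulr_gt0|nra].
  by apply/funext => k; rewrite exprMn mulrA.
by move=> /eqP; rewrite mulf_eq0 expf_eq0 (gt_eqF e2) andbF orbF => /eqP.
Qed.

(** * The identity theorem on the real line *)

Section complex_series.
Context {R : realType}.
Implicit Type c : nat -> R[i].

Lemma cvg_Re (u : nat -> R[i]^o) (l : R[i]^o) : (u @ \oo --> l)%classic ->
  ((fun n => complex.Re (u n)) @ \oo --> (complex.Re l : R))%classic.
Proof.
move=> /cvgrPdist_lt ul; apply/cvgrPdist_lt => eps eps0.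
have epsC : 0 < (eps%:C)%C by rewrite ltcR.
near=> n.
rewrite -raddfB -ltcR; apply: le_lt_trans (normc_ge_Re _) _.
near: n; exact: ul.
Unshelve. all: by end_near. Qed.

Lemma normc_ge_Im (z : R[i]) : (`|complex.Im z|%:C)%C <= `|z|.
Proof. by rewrite normc_def lecR -sqrtr_sqr ler_wsqrtr// lerDr sqr_ge0. Qed.

Lemma cvg_Im (u : nat -> R[i]^o) (l : R[i]^o) : (u @ \oo --> l)%classic ->
  ((fun n => complex.Im (u n)) @ \oo --> (complex.Im l : R))%classic.
Proof.
move=> /cvgrPdist_lt ul; apply/cvgrPdist_lt => eps eps0.
have epsC : 0 < (eps%:C)%C by rewrite ltcR.
near=> n.
rewrite -raddfB -ltcR; apply: le_lt_trans (normc_ge_Im _) _.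
near: n; exact: ul.
Unshelve. all: by end_near. Qed.

Lemma Re_series c (h : R) :
  (fun N => complex.Re (series (fun n => c n * (h%:C)%C ^+ n) N)) =
  series (fun n => complex.Re (c n) * h ^+ n).
Proof.
apply/funext => N; rewrite /series/= raddf_sum; apply: eq_bigr => n _ /=.
by rewrite -rmorphXn/=; case: (c n) => x y /=; rewrite mulr0 subr0.
Qed.

Lemma Im_series c (h : R) :
  (fun N => complex.Im (series (fun n => c n * (h%:C)%C ^+ n) N)) =
  series (fun n => complex.Im (c n) * h ^+ n).
Proof.
apply/funext => N; rewrite /series/= raddf_sum; apply: eq_bigr => n _ /=.
by rewrite -rmorphXn/=; case: (c n) => x y /=; rewrite mulr0 add0r.
Qed.

Lemma complex_pseries_coef_eq0 c (e : R) : 0 < e ->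
  (forall h : R, 0 < h -> h < e ->
    (series (fun n => c n * (h%:C)%C ^+ n : R[i]^o) @ \oo -->
       (0 : R[i]^o))%classic) ->
  forall n, c n = 0.
Proof.
move=> e0 sum0 n; apply/eqP; rewrite eq_complex; apply/andP; split; apply/eqP.
- apply: (pseries_coef_eq0 (a := fun n => complex.Re (c n)) e0) => h h0 he.
  by rewrite -Re_series; exact: (cvg_Re (sum0 h h0 he)).
- apply: (pseries_coef_eq0 (a := fun n => complex.Im (c n)) e0) => h h0 he.
  by rewrite -Im_series; exact: (cvg_Im (sum0 h h0 he)).
Qed.

(** Otherwise the half-lines on which [phi] vanishes would be bounded on the
    left.  The infimum of their endpoints is again such an endpoint, and the
    vanishing of the power series there extends the half-line further. *)
Lemma real_analytic_eq0 (phi : R -> R[i]) (s : R) : real_analytic phi ->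
  (forall t, s <= t -> phi t = 0) -> forall t, phi t = 0.
Proof.
move=> analytic phis t; apply: contrapT => phit.
pose E := [set u : R | forall v, u < v -> phi v = 0]%classic.
have Es : E s by move=> v /ltW; exact: phis.
have Elb : has_inf E.
  split; first by exists s.
  by exists t => u Eu; rewrite leNgt; apply/negP => /Eu.
have phi_inf v : inf E < v -> phi v = 0.
  move=> infv; have [|u Eu] := @inf_adherent _ E (v - inf E) _ Elb.
    by rewrite subr_gt0.
  by rewrite addrC subrK; exact: Eu.
have [c [e [e0 sum_phi]]] := analytic (inf E).
have c0 : forall n, c n = 0.
  apply: (complex_pseries_coef_eq0 e0) => h h0 he.
  have := sum_phi (inf E + h); rewrite addrAC subrr add0r gtr0_norm//.
  by move=> /(_ he); rewrite phi_inf// ltrDl.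
have phi_near v : `|v - inf E| < e -> phi v = 0.
  move=> /sum_phi; rewrite (_ : series _ = cst 0).
    move=> sum0; apply: (cvg_unique _ sum0); first exact: norm_hausdorff.
    exact: cvg_cst.
  by apply/funext => N; rewrite /series/= big1// => n _; rewrite c0 mul0r.
have : E (inf E - e / 2).
  move=> v vE; have [|vinf] := ltP (inf E) v; first exact: phi_inf.
  by apply: phi_near; rewrite ler0_norm; lra.
move=> /(ge_inf Elb.2); lra.
Qed.

End complex_series.

(** * The characteristic function and the gain for the cosine *)

Section charfun.
Context {R : realType} {d : measure_display} {T : measurableType d}.
Context {P : probability T R} (X : {RV P >-> R}).

Let cos_Lfun (r : R) : (fun w => cos (r * X w)) \in Lfun P 1.
Proof.
apply/Lfun1_integrable; apply: measurable_bounded_integrable => //.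
- exact: fin_num_fun_lty.
- apply: (measurableT_comp (@measurable_cos_setT R)).
  by apply: measurable_funM => //; exact: measurable_cst.
- exists 1; split => // y y1 w _ /=.
  by rewrite ler_norml (le_trans (cos_le1 _) (ltW y1))//
    (le_trans _ (cos_geN1 _))// lerN2 ltW.
Qed.

Let sin_Lfun (r : R) : (fun w => sin (r * X w)) \in Lfun P 1.
Proof.
apply/Lfun1_integrable; apply: measurable_bounded_integrable => //.
- exact: fin_num_fun_lty.
- apply: (@measurableT_comp _ _ _ _ _ _ (@sin R)).
    by apply: continuous_measurable_fun; exact: continuous_sin.
  by apply: measurable_funM => //; exact: measurable_cst.
- exists 1; split => // y y1 w _ /=.
  by rewrite ler_norml (le_trans (sin_le1 _) (ltW y1))//
    (le_trans _ (sin_geN1 _))// lerN2 ltW.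
Qed.

Lemma expectation_cos_charfun (a r : R) :
  ('E_P[fun w => (cos_payoff R (a + r * X w))%R])%E =
  (cos a * complex.Re (charfun X r) - sin a * complex.Im (charfun X r))%:E.
Proof.
have -> : (fun w => cos_payoff R (a + r * X w)) =
    ((cos a) \o* (fun w => cos (r * X w)))%R \-
    ((sin a) \o* (fun w => sin (r * X w)))%R.
  by apply/funext => w; rewrite /= cosD mulrC [sin a * _]mulrC.
rewrite expectationB ?Lfun_scale// !expectationZl//= EFinD EFinN !EFinM.
by rewrite !fineK ?expectation_fin_num.
Qed.

Lemma charfun0 : charfun X 0 = 1.
Proof.
rewrite /charfun /complex_expectation /=.
have -> : (fun w => cos (0 * X w)) = cst 1.
  by apply/funext => w; rewrite mul0r cos0.
have -> : (fun w => sin (0 * X w)) = cst 0.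
  by apply/funext => w; rewrite mul0r sin0.
by rewrite !expectation_cst.
Qed.

Lemma charfunN (t : R) : charfun X (- t) = ((charfun X t)^*)%C.
Proof.
rewrite /charfun /complex_expectation /=.
have -> : (fun w => cos (- t * X w)) = (fun w => cos (t * X w)).
  by apply/funext => w; rewrite mulNr cosN.
have -> : (fun w => sin (- t * X w)) = (-1) \o* (fun w => sin (t * X w)).
  by apply/funext => w; rewrite /= mulNr sinN mulrN1.
by rewrite expectationZl// EFinN mulN1e fineN.
Qed.

Lemma gain_cos_eq0 (r : R) : charfun X r = 0 -> gain X (cos_payoff R) r = 0%E.
Proof.
move=> r0; rewrite /gain (_ : [set _ | _ in _]%classic = [set 0%E]%classic).
  by rewrite ereal_sup1.
apply/seteqP; split => [_ [a _ <-]|_ ->] /=.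
  by rewrite expectation_cos_charfun r0 /= !mulr0 subr0.
by exists 0 => //; rewrite expectation_cos_charfun r0 /= !mulr0 subr0.
Qed.

(** The real part of [e^{ia} phi(r)] takes the values [x], [-x], [y] and [-y],
    where [phi(r) = x + iy], as [a] runs over multiples of [pi / 2]. *)
Lemma charfun_eq0_gain (r : R) :
  (gain X (cos_payoff R) r <= 0)%E -> charfun X r = 0.
Proof.
move=> gain0.
have le0 a : cos a * complex.Re (charfun X r) -
             sin a * complex.Im (charfun X r) <= 0.
  rewrite -lee_fin -expectation_cos_charfun; apply: le_trans gain0.
  by apply: ereal_sup_ubound; exists a.
have := le0 0; have := le0 pi; have := le0 (pi / 2); have := le0 (- (pi / 2)).
rewrite cosN sinN cos_pihalf sin_pihalf cospi sinpi cos0 sin0.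
by case: (charfun X r) => x y /= *; have [-> ->] : x = 0 /\ y = 0 by lra.
Qed.

End charfun.

Theorem corollary1p9 (R : realType) (d : measure_display)
    (T : measurableType d) (P : probability T R) (X : {RV P >-> R}) :
  real_analytic (charfun X) ->
  (exists t : R, charfun X t = 0) ->
  ~ reasonable X (cos_payoff R).
Proof.
move=> analytic [t0 phit0] reas.
have [t [t_gt0 phit]] : exists t, 0 < t /\ charfun X t = 0.
  have [t0_gt0|t0_lt0|t00] := ltgtP 0 t0; first by exists t0.
  - by exists (- t0); rewrite oppr_gt0 charfunN phit0 conjc0.
  - by move: phit0; rewrite -t00 charfun0 => /eqP; rewrite oner_eq0.
have : charfun X 0 = 0.
  apply: (real_analytic_eq0 analytic (s := t)) => s ts.
  by apply: charfun_eq0_gain; rewrite -(gain_cos_eq0 phit); exact: reas.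
by rewrite charfun0 => /eqP; rewrite oner_eq0.
Qed.
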